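(* Let $\hat{\bm x}$ be the penalized maximum likelihood estimator with regularization parameters $\rho_1,\rho_2\ge0$ and $MSE_\phi$ the mean squared error of the predicted scores, in the multi-relational network model described in the context. Let the number of entities $N \to \infty$ and let $C, K, U, d_E, d_R, \alpha, \gamma$ be absolute constants (not depending on $N$). Assume that $\bm x^* \in \Theta = \mathcal{E}^N \times \mathcal{R}^K$, where $\mathcal{E}$ and $\mathcal{R}$ are Euclidean balls of radius $U$ centered at $\bm 0$; that $|\phi(\bm u) - \phi(\bm v)| \le \alpha \|\bm u - \bm v\|$ for all $\bm u, \bm v \in \mathcal{E}^2 \times \mathcal{R}$; and that $\rho_1+\rho_2 = o(\log N)$. Then: (i) If $t>0$ is a fixed constant, $$\log P\left(MSE_\phi \geq t\right) \lesssim - \frac{\sigma(C)\left(1-\sigma(C)\right) t}{10C}\,n.$$ (ii) If $t = \frac{20C}{\sigma(C)(1-\sigma(C))} \frac{m}{n} \log \frac{n}{m}$, $$\log P\left(MSE_\phi\geq t\right) \lesssim - m \log \frac{n}{m}.$$ (iii) Furthermore, $$E\left[MSE_\phi\right] \lesssim \frac{20C}{\sigma(C)\left(1-\sigma(C)\right)}\, \frac{m}{n} \log \frac{n}{m}.$$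
   Context: Notation: $[N]=\{1,\dots,N\}$; $\sigma(x) = e^x/(1+e^x)$; $\|\cdot\|$ is the Euclidean norm and $\|\cdot\|_1$ the $L_1$ norm. For positive sequences, $a \lesssim b$ means $\limsup_{N\to\infty} a/b \le 1$; for negative sequences, $a \lesssim b$ means $\liminf_{N\to\infty} a/b \ge 1$. Model: There are $N$ entities and $K$ relations; $\Lambda = [N]\times[N]\times[K]$ is the set of edges. $\mathcal{E}\subset\mathbb{R}^{d_E}$ and $\mathcal{R}\subset\mathbb{R}^{d_R}$ are compact sets, $\Theta = \mathcal{E}^N\times\mathcal{R}^K$, and elements of $\Theta$ are written $\bm x = (\bm\theta_1,\dots,\bm\theta_N,\bm w_1,\dots,\bm w_K)$. For $\lambda=(i,j,k)\in\Lambda$ put $\bm x_\lambda = (\bm\theta_i,\bm\theta_j,\bm w_k)$. Given a score function $\phi:\mathcal{E}^2\times\mathcal{R}\to\mathbb{R}$, let $M_\lambda(\bm x) = \sigma(\phi(\bm x_\lambda))$ and $M(\bm x) = (M_\lambda(\bm x))_{\lambda\in\Lambda}$. The true parameter is $\bm x^*$, $M^* = M(\bm x^* )$, and the $Y_\lambda$, $\lambda\in\Lambda$, are independent Bernoulli$(M^*_\lambda)$ variables. Each edge is observed independently with probability $\gamma\in(0,1]$, independently of $Y$; $\mathcal{S}\subset\Lambda$ is the random set of observed edges. Put $n = \gamma N^2 K$, $m = N d_E + K d_R$, and $C = \sup_{\bm u\in\mathcal{E}^2\times\mathcal{R}}|\phi(\bm u)|$; it is assumed throughout that $C\ge 2$.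 Estimator: the log-likelihood is $l(\bm x;Y_{\mathcal{S}}) = \sum_{\lambda\in\mathcal{S}} \big[Y_\lambda\log M_\lambda(\bm x) + (1-Y_\lambda)\log(1-M_\lambda(\bm x))\big]$ and the penalized log-likelihood is $l_\rho(\bm x;Y_{\mathcal{S}}) = l(\bm x;Y_{\mathcal{S}}) - \rho_1\|\bm x\|_1 - \rho_2\|\bm x\|^2$, where $\rho_1,\rho_2\ge 0$ may depend on $N$. The penalized maximum likelihood estimator $\hat{\bm x}$ is a maximizer of $l_\rho(\bm x;Y_{\mathcal{S}})$ over $\bm x\in\Theta$ (not necessarily unique). Loss: $MSE_\phi = \frac{1}{|\Lambda|}\sum_{\lambda\in\Lambda}\left(\phi(\hat{\bm x}_\lambda)-\phi(\bm x^*_\lambda)\right)^2$. *)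

(* Defs.v *)
From HB Require Import structures.
From mathcomp Require Export all_boot all_order all_algebra.
From mathcomp Require Export all_classical all_reals all_analysis.
Export Order.TTheory GRing.Theory Num.Theory.
Export numFieldNormedType.Exports.

Set Implicit Arguments.
Unset Strict Implicit.
Unset Printing Implicit Defensive.

Local Open Scope classical_set_scope.
Local Open Scope ring_scope.

(** * Asymptotic comparison *)

Section Asymptotics.
Context {R : realType}.

(* The left-hand sequence is extended-real so that [log 0 = -oo] is allowed;
   the two versions are meant for eventually positive, resp. eventually
   negative, right-hand sides [b]. *)
Definition lesssim_pos (a : nat -> \bar R) (b : nat -> R) : Prop :=
  (limn_esup (fun N => a N / (b N)%:E) <= 1)%E.

Definition lesssim_neg (a : nat -> \bar R) (b : nat -> R) : Prop :=
  (1 <= limn_einf (fun N => a N / (b N)%:E))%E.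

End Asymptotics.

(** * Euclidean geometry *)

Section Euclidean.
Context {R : realType}.

(* The norm [`|_|] that the library puts on row vectors is the sup norm, hence
   an explicit Euclidean norm and Euclidean closed balls. *)
Definition enorm (d : nat) (v : 'rV[R]_d) : R :=
  Num.sqrt (\sum_(i < d) v 0 i ^+ 2).

Definition eball (d : nat) (r : R) : set 'rV[R]_d := [set v | enorm v <= r].

Definition l1norm (d : nat) (v : 'rV[R]_d) : R := \sum_(i < d) `|v 0 i|.

Definition enorm3 (d1 d2 d3 : nat)
    (u : 'rV[R]_d1 * 'rV[R]_d2 * 'rV[R]_d3) : R :=
  enorm (row_mx (row_mx u.1.1 u.1.2) u.2).

End Euclidean.

(** * Multi-relational network model *)

Definition edge (N K : nat) : finType := ('I_N * 'I_N * 'I_K)%type.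

Section Model.
Context {R : realType} {N K dE dR : nat}.

Definition sigmoid (x : R) : R := expR x / (1 + expR x).

Definition param : Type := (('I_N -> 'rV[R]_dE) * ('I_K -> 'rV[R]_dR))%type.

Definition Theta (E : set 'rV[R]_dE) (W : set 'rV[R]_dR) : set param :=
  [set x | (forall i, E (x.1 i)) /\ (forall k, W (x.2 k))].

Definition param_l1norm (x : param) : R :=
  \sum_(i < N) l1norm (x.1 i) + \sum_(k < K) l1norm (x.2 k).

Definition param_enorm (x : param) : R :=
  Num.sqrt (\sum_(i < N) enorm (x.1 i) ^+ 2 + \sum_(k < K) enorm (x.2 k) ^+ 2).

Definition coord (x : param) (l : edge N K) :
    'rV[R]_dE * 'rV[R]_dE * 'rV[R]_dR :=
  (x.1 l.1.1, x.1 l.1.2, x.2 l.2).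

Context (phi : 'rV[R]_dE * 'rV[R]_dE * 'rV[R]_dR -> R).

Definition score_sup (E : set 'rV[R]_dE) (W : set 'rV[R]_dR) : R :=
  sup [set `|phi u| | u in E `*` E `*` W].

Definition score_lipschitz (E : set 'rV[R]_dE) (W : set 'rV[R]_dR)
    (alpha : R) : Prop :=
  forall u v, (E `*` E `*` W) u -> (E `*` E `*` W) v ->
    `|phi u - phi v| <= alpha * enorm3 (u - v).

Definition edge_prob (x : param) (l : edge N K) : R :=
  sigmoid (phi (coord x l)).

Definition loglik (y : edge N K -> bool) (S : {set edge N K}) (x : param) : R :=
  \sum_(l in S) ((y l)%:R * ln (edge_prob x l) +
                 (1 - (y l)%:R) * ln (1 - edge_prob x l)).

Definition penalized_loglik (rho1 rho2 : R) (y : edge N K -> bool)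
    (S : {set edge N K}) (x : param) : R :=
  loglik y S x - rho1 * param_l1norm x - rho2 * param_enorm x ^+ 2.

Definition is_penalized_mle (E : set 'rV[R]_dE) (W : set 'rV[R]_dR)
    (rho1 rho2 : R) (y : edge N K -> bool) (S : {set edge N K})
    (x : param) : Prop :=
  Theta E W x /\
  forall x', Theta E W x' ->
    penalized_loglik rho1 rho2 y S x' <= penalized_loglik rho1 rho2 y S x.

Definition MSE (x xstar : param) : R :=
  (\sum_(l : edge N K) (phi (coord x l) - phi (coord xstar l)) ^+ 2) /
  #|edge N K|%:R.

End Model.
Arguments param R N K dE dR : clear implicits.

Definition mutually_independent {R : realType} (d : measure_display)
    (T : measurableType d) (P : probability T R) (d' : measure_display)
    (T' : measurableType d') (I : finType) (X : I -> T -> T') : Prop :=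
  forall (J : {set I}) (B : I -> set T'), (forall i, measurable (B i)) ->
    P (\bigcap_(i in [set` J]) X i @^-1` B i) =
    (\prod_(i in J) P (X i @^-1` B i))%E.

(* [Y l] is the value of edge [l] and [O l] tells whether [l] is observed. *)
Record observation_model {R : realType} (N K : nat) (d : measure_display)
    (T : measurableType d) (P : probability T R) (Mstar : edge N K -> R)
    (gamma : R) (Y O : edge N K -> {RV P >-> bool}) : Prop := {
  label_law : forall l, distribution P (Y l) =1 bernoulli_prob (Mstar l);
  observed_law : forall l, distribution P (O l) =1 bernoulli_prob gamma;
  label_observed_indep :
    mutually_independent P (fun e : edge N K + edge N K =>
      match e with inl l => (Y l : T -> bool) | inr l => (O l : T -> bool) end)
}.

Definition observed_set (N K : nat) (o : edge N K -> bool) : {set edge N K} :=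
  [set l | o l]%SET.

Definition eff_size {R : realType} (gamma : R) (K N : nat) : R :=
  gamma * N%:R ^+ 2 * K%:R.

Definition num_params {R : realType} (dE dR K N : nat) : R :=
  (N * dE + K * dR)%:R.

(* Main.v *)
(** Chernoff's bound at exponent 1/2 for the log-likelihood ratio reduces, edge
    by edge, to the Bhattacharyya coefficient of two Bernoulli laws with
    log-odds [a], [b] in [[-C, C]], which is at most [1 - kappa (a - b)^2] with
    [kappa = sigma(C) (1 - sigma(C)) / (10 C)].  Hence a fixed parameter whose
    squared error is at least [t] beats the true one with probability at most
    [exp (- kappa t n)].  Rounding every coordinate to mesh [1/N] leaves
    [(O(N))^m] cells, and moving to a cell representative changes the
    log-likelihood by [O(N)]; the penalty costs [O(N (rho1 + rho2))].  A union
    bound over cells gives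
    [P(MSE >= t) <= exp (m log N + c N (1 + rho1 + rho2) - kappa t n)]
    uniformly in [t], and [log (n/m) ~ log N] turns this into (i) and (ii).
    For (iii), [E MSE <= t + 4 C^2 P(MSE >= t)] with the [t] of (ii). *)

From mathcomp Require Import ring lra measurable_realfun.
Require Import Defs.

Set Implicit Arguments.
Unset Strict Implicit.
Unset Printing Implicit Defensive.

Local Open Scope classical_set_scope.
Local Open Scope ring_scope.

(** * Bernoulli masses in log-odds form and the Bhattacharyya bound *)

Definition bern_mass {R : realType} (y : bool) (a : R) : R :=
  if y then sigmoid a else 1 - sigmoid a.
Arguments bern_mass : simpl never.

Section BernoulliLikelihood.
Context {R : realType}.
Implicit Types a b c h : R.

Lemma bern_massE y a : bern_mass y a = (if y then expR a else 1) / (1 + expR a).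
Proof.
have := expR_gt0 a; rewrite /bern_mass /sigmoid; case: y => // e0.
by field; apply/lt0r_neq0; lra.
Qed.

Lemma bern_mass_gt0 y a : 0 < bern_mass y a.
Proof.
have e0 := expR_gt0 a; rewrite bern_massE divr_gt0 ?addr_gt0//.
by case: y.
Qed.

Lemma bern_mass_sum a : bern_mass true a + bern_mass false a = 1.
Proof. by rewrite /bern_mass; lra. Qed.

Lemma bern_mass_le y a b : bern_mass y a <= expR `|a - b| * bern_mass y b.
Proof.
have ea : 0 < expR a := expR_gt0 a; have eb : 0 < expR b := expR_gt0 b.
have le_exp (u v : R) : expR u <= expR `|u - v| * expR v.
  by rewrite -expRD ler_expR -lerBlDr ler_norm.
have r1 : 1 <= expR `|a - b| by rewrite -[1]expR0 ler_expR.
have lab := le_exp a b; have lba := le_exp b a; rewrite distrC in lba.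
rewrite !bern_massE mulrA ler_pdivrMr ?addr_gt0// mulrAC ler_pdivlMr ?addr_gt0//.
by case: y; nra.
Qed.

(** Logarithm of [bern_mass_le] taken in both directions. Rounding the scores therefore moves the
    log-likelihood of an edge by no more than its score. *)
Lemma ln_bern_mass_lipschitz y a b :
  `|ln (bern_mass y a) - ln (bern_mass y b)| <= `|a - b|.
Proof.
have ln_le (u v : R) : ln (bern_mass y u) <= `|u - v| + ln (bern_mass y v).
  rewrite -[X in X + _]expRK -lnM ?posrE ?expR_gt0 ?bern_mass_gt0//.
  by rewrite ler_ln ?posrE ?mulr_gt0 ?expR_gt0 ?bern_mass_gt0// bern_mass_le.
have := ln_le a b; have := ln_le b a; rewrite (distrC b) ler_norml.
by move=> ? ?; apply/andP; split; lra.
Qed.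

(* Exact would be [2 * h]; the weaker constant follows from
   [(1 + h / 4) ^ 4 <= expR h] and is enough below. *)
Lemma expRB_ge h : 0 <= h -> 7 / 4 * h <= expR h - expR (- h).
Proof.
move=> h0; set v := h / 4; have v0 : 0 <= v by rewrite divr_ge0.
have hv : h = 4 * v by rewrite /v; field.
have Ae : (1 + v) ^+ 4 <= expR h.
  rewrite hv -[4]/(4%:R) expRM_natl lerXn2r ?nnegrE ?expR_ge0 ?addr_ge0//.
  exact: expR_ge1Dx.
have A0 : 0 < (1 + v) ^+ 4 by rewrite exprn_gt0 ?ltr_wpDr.
apply: (@le_trans _ _ ((1 + v) ^+ 4 - ((1 + v) ^+ 4)^-1)); last first.
  by rewrite expRN lerB// lef_pV2 ?posrE// expR_gt0.
rewrite -(ler_pM2r A0) mulrBl mulVf ?gt_eqF// hv -subr_ge0.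
set w := _ - _.
have -> : w = v + 14 * v ^+ 3 + 42 * v ^+ 4 + 49 * v ^+ 5 + 28 * v ^+ 6 +
    8 * v ^+ 7 + v ^+ 8 by rewrite /w; field.
by rewrite !addr_ge0// ?mulr_ge0// exprn_ge0.
Qed.

Section Bhattacharyya.
Variable C : R.
Let s := sigmoid C * (1 - sigmoid C).

Lemma sigmoid_prodE a : sigmoid a * (1 - sigmoid a) = expR a / (1 + expR a) ^+ 2.
Proof.
have := expR_gt0 a; rewrite /sigmoid => e0.
by field; apply/lt0r_neq0; lra.
Qed.

Lemma sigmoid_prod_gt0 a : 0 < sigmoid a * (1 - sigmoid a).
Proof. by rewrite sigmoid_prodE divr_gt0 ?exprn_gt0 ?addr_gt0 ?expR_gt0. Qed.

(** The derivative of the sigmoid is even and decreasing in [|a|]. After cross-multiplication the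
    difference factors as [(expR C - expR a) * (expR a * expR C - 1)]. *)
Lemma sigmoid_prod_min a : `|a| <= C -> s <= expR a / (1 + expR a) ^+ 2.
Proof.
rewrite ler_norml => /andP[Ca aC]; rewrite /s sigmoid_prodE.
have x0 : 0 < expR a := expR_gt0 a.
have xy : expR a <= expR C by rewrite ler_expR.
have xy1 : 1 <= expR a * expR C by rewrite -expRD -[1]expR0 ler_expR; lra.
have y0 : 0 < expR C := expR_gt0 C.
rewrite ler_pdivrMr ?exprn_gt0 ?addr_gt0// mulrAC ler_pdivlMr ?exprn_gt0 ?addr_gt0//.
rewrite -subr_ge0.
set w := _ - _.
have -> : w = (expR C - expR a) * (expR a * expR C - 1) by rewrite /w; ring.
by rewrite mulr_ge0; lra.
Qed.

(** Follows from [C ^ 2 <= expR C], itself a consequence of [C <= (1 + C / 4) ^ 2]. It later keeps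
    [z = s * h ^ 2] in [[0, 1]]. *)
Lemma sigmoid_prod_sqr_le1 : 2 <= C -> s * C ^+ 2 <= 1.
Proof.
move=> C2.
have y0 : 0 < expR C := expR_gt0 C.
have h1 := expR_ge1Dx (C / 4).
have CE : C <= expR (C / 4) ^+ 2.
  by apply: (@le_trans _ _ ((1 + C / 4) ^+ 2)); [have := sqr_ge0 (1 - C / 4); nra|rewrite lerXn2r ?nnegrE ?expR_ge0//; lra].
have CC : C ^+ 2 <= expR C.
  have -> : expR C = (expR (C / 4) ^+ 2) ^+ 2.
    by rewrite -exprM -expRM_natl; congr expR; field.
  by rewrite lerXn2r ?nnegrE ?sqr_ge0//; lra.
rewrite /s sigmoid_prodE mulrAC ler_pdivrMr ?exprn_gt0 ?addr_gt0// mul1r.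
by nra.
Qed.

(** With [e], [f] the exponentials of the half log-odds, the coefficient is [(1 + e * f) / sqrt D].
    Squaring turns the claim into a lower bound on [D / (1 + e * f) ^ 2], which reduces to a
    polynomial inequality in [z]. *)
Lemma bhattacharyya_le a b : 2 <= C -> `|a| <= C -> `|b| <= C ->
  \sum_y Num.sqrt (bern_mass y a * bern_mass y b) <=
  1 - s / (10 * C) * (a - b) ^+ 2.
Proof.
move=> C2; wlog ab : a b / b <= a.
  move=> wl; have [|/ltW] := leP b a; first exact: wl.
  move=> ba aC bC; rewrite -sqrrN opprB; under eq_bigr do rewrite mulrC; exact: wl.
move=> aC bC; rewrite big_bool /=.
pose e := expR (a / 2); pose f := expR (b / 2); pose h := (a - b) / 2.
have [e0 f0] : 0 < e /\ 0 < f by rewrite !expR_gt0.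
have Ea : expR a = e ^+ 2 by rewrite /e -expRM_natl; congr expR; field.
have Eb : expR b = f ^+ 2 by rewrite /f -expRM_natl; congr expR; field.
pose D := (1 + e ^+ 2) * (1 + f ^+ 2).
have D0 : 0 < D by rewrite mulr_gt0 ?addr_gt0 ?exprn_gt0.
have -> : Num.sqrt (bern_mass true a * bern_mass true b) +
    Num.sqrt (bern_mass false a * bern_mass false b) = (1 + e * f) / Num.sqrt D.
  rewrite !bern_massE /= Ea Eb !mulf_div -exprMn mulr1 -/D.
  rewrite div1r (sqrtrM _ (sqr_ge0 (e * f))) sqrtr_sqr.
  rewrite ger0_norm ?mulr_ge0 ?(ltW e0) ?(ltW f0)// sqrtrV ?(ltW D0)//.
  by rewrite addrC mulrDl mul1r.
have sD0 : 0 < Num.sqrt D by rewrite sqrtr_gt0.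
have h0 : 0 <= h by rewrite /h; lra.
have hC : h <= C by move: aC bC; rewrite /h !ler_norml; lra.
have s0 : 0 < s := sigmoid_prod_gt0 C.
pose z := s * h ^+ 2.
have z0 : 0 <= z by rewrite mulr_ge0 ?sqr_ge0 ?ltW.
have z1 : z <= 1.
  apply: le_trans (sigmoid_prod_sqr_le1 C2); rewrite ler_pM2l// lerXn2r ?nnegrE//; lra.
pose k := s / (10 * C) * (a - b) ^+ 2.
(* This is where [2 <= C] enters, through [2 / C <= 1]. *)
have kz : k <= z / 5.
  have -> : k = (2 / C) * (z / 5) by rewrite /k /z /h; field; apply/lt0r_neq0; lra.
  rewrite ler_piMl ?divr_ge0// ler_pdivrMr; lra.
rewrite ler_pdivrMr// -/k.
have k1 : 0 <= 1 - k by lra.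
have ef0 : 0 < 1 + e * f by rewrite addr_gt0 ?mulr_gt0.
rewrite -(@ler_pXn2r _ 2) ?nnegrE ?(mulr_ge0 k1) ?(ltW ef0) ?(ltW sD0)//.
rewrite exprMn sqr_sqrtr ?(ltW D0)//.
(* The cross term makes the coefficient [(1 + x) ^ (-1/2)] with
   [x = (e - f) ^ 2 / (1 + e * f) ^ 2], bounded below by [(7/8) ^ 2 * z]. *)
have DE : D = (1 + e * f) ^+ 2 + (e - f) ^+ 2 by rewrite /D; ring.
(* [h + b] is the midpoint [(a + b) / 2], so [sigmoid_prod_min] applies to it and bounds [s] in
   terms of [e * f]. *)
have hmid : `|h + b| <= C.
  by move: aC bC; rewrite /h !ler_norml => /andP[? ?] /andP[? ?]; apply/andP; split; lra.
have efE : e * f = expR (h + b) by rewrite /e /f /h -expRD; congr expR; field.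
have sle := sigmoid_prod_min hmid; rewrite -efE in sle.
(* Since [e / f = x ^ 2], the ratio [(e - f) ^ 2 / (e * f)] is [(x - x^-1) ^ 2], and [expRB_ge] at
   [h / 2] bounds it below with constant [(7 / 8) ^ 2]. *)
have gap : 49 / 64 * h ^+ 2 * (e * f) <= (e - f) ^+ 2.
  pose x := expR (h / 2).
  have x0 : 0 < x := expR_gt0 _.
  have xh : 7 / 8 * h <= x - x^-1.
    by have := @expRB_ge (h / 2); rewrite expRN -/x; lra.
  have xe : e = x ^+ 2 * f.
    by rewrite /e /f /x -expRM_natl -expRD; congr expR; rewrite /h; field.
  have -> : (e - f) ^+ 2 = (x - x^-1) ^+ 2 * (e * f).
    by rewrite xe; field; rewrite gt_eqF.
  rewrite ler_pM2r ?mulr_gt0//.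
  have -> : 49 / 64 * h ^+ 2 = (7 / 8 * h) ^+ 2 by field.
  by rewrite lerXn2r ?nnegrE//; lra.
have ef1 : 0 < (1 + e * f) ^+ 2 by rewrite exprn_gt0.
have Dz : (1 + e * f) ^+ 2 * (1 + 49 / 64 * z) <= D.
  rewrite DE mulrDr mulr1 lerD2l; apply: le_trans gap.
  have -> : (1 + e * f) ^+ 2 * (49 / 64 * z) =
      49 / 64 * h ^+ 2 * (s * (1 + e * f) ^+ 2) by rewrite /z; ring.
  apply: ler_wpM2l; first by rewrite mulr_ge0 ?sqr_ge0//; lra.
  by rewrite -ler_pdivlMr.
have kz2 : 1 <= (1 - k) ^+ 2 * (1 + 49 / 64 * z).
  have kz2 : (1 - z / 5) ^+ 2 <= (1 - k) ^+ 2.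
    by rewrite lerXn2r ?nnegrE//; lra.
  (* The expansion has positive linear coefficient [49 / 64 - 2 / 5], which outweighs the negative
     quadratic one on [[0, 1]]. *)
  apply: (@le_trans _ _ ((1 - z / 5) ^+ 2 * (1 + 49 / 64 * z))).
    by nra.
  by rewrite ler_wpM2r//; lra.
apply: le_trans (ler_wpM2l (sqr_ge0 (1 - k)) Dz).
by rewrite mulrCA ler_peMr// ltW.
Qed.

End Bhattacharyya.

End BernoulliLikelihood.

(** * Chernoff bound for the likelihood ratio on the finite outcome space *)

Section FiniteChernoff.
Context {R : realType} {I : finType}.
Implicit Types (f : {ffun I -> bool * bool}) (a b : I -> R).

(** Outcomes keep the labels of unobserved edges too, so that their law is a full product over
    edges. *)
Definition obs_mass (gamma : R) b f : R :=
  \prod_i (bern_mass (f i).1 (b i) * bernoulli_pmf gamma (f i).2).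

Definition obs_loglik a f : R :=
  \sum_(i | (f i).2) ln (bern_mass (f i).1 (a i)).

Lemma obs_mass_ge0 gamma b f : 0 <= gamma <= 1 -> 0 <= obs_mass gamma b f.
Proof.
move=> g01; apply: prodr_ge0 => i _.
by apply: mulr_ge0; [exact/ltW/bern_mass_gt0|exact: bernoulli_pmf_ge0].
Qed.

Lemma sqrt_likelihood_ratio a b f :
  \prod_(i | (f i).2)
    Num.sqrt (bern_mass (f i).1 (a i) / bern_mass (f i).1 (b i)) =
  expR ((obs_loglik a f - obs_loglik b f) / 2).
Proof.
rewrite /obs_loglik -sumrB mulr_suml expR_sum.
apply: eq_bigr => i _.
have [a0 b0] := (bern_mass_gt0 (f i).1 (a i), bern_mass_gt0 (f i).1 (b i)).
rewrite -ln_div ?posrE// -powR12_sqrt ?divr_ge0 ?(ltW a0) ?(ltW b0)//.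
by rewrite /powR gt_eqF ?divr_gt0// mulrC.
Qed.

(* Markov's inequality for the square root of the likelihood ratio. *)
Lemma loglik_ratio_chernoff (C gamma delta : R) a b :
  2 <= C -> 0 <= gamma <= 1 ->
  (forall i, `|a i| <= C) -> (forall i, `|b i| <= C) ->
  \sum_(f | obs_loglik b f - delta <= obs_loglik a f) obs_mass gamma b f <=
  expR (delta / 2 - gamma * (sigmoid C * (1 - sigmoid C) / (10 * C)) *
                    \sum_i (a i - b i) ^+ 2).
Proof.
move=> C2 g01 aC bC; have /andP[g0 g1] := g01.
pose r i (p : bool * bool) : R :=
  if p.2 then Num.sqrt (bern_mass p.1 (a i) / bern_mass p.1 (b i)) else 1.
have r_ge0 i p : 0 <= r i p by rewrite /r; case: ifP.
have prod_r f : \prod_i r i (f i) = expR ((obs_loglik a f - obs_loglik b f) / 2).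
  by rewrite -sqrt_likelihood_ratio [RHS]big_mkcond.
pose w i (p : bool * bool) := bern_mass p.1 (b i) * bernoulli_pmf gamma p.2.
apply: (@le_trans _ _ (\sum_(f : {ffun I -> bool * bool}) expR (delta / 2) * \prod_i (w i (f i) * r i (f i)))).
  rewrite big_mkcond /=; apply: ler_sum => f _.
  rewrite big_split /= prod_r mulrCA -expRD -/(obs_mass gamma b f).
  have m0 := obs_mass_ge0 b f g01.
  case: ifPn => [ab|_]; last by rewrite mulr_ge0 ?expR_ge0.
  by rewrite ler_peMr// -[leLHS]expR0 ler_expR; lra.
rewrite -mulr_sumr expRD ler_pM2l ?expR_gt0//.
(* Independence across edges: the sum of products over outcomes becomes a product of one-edge
   sums. *)
rewrite -(bigA_distr_bigA (fun i p => w i p * r i p)) mulr_sumr -sumrN.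
rewrite expR_sum; apply: ler_prod => i _.
apply/andP; split.
  apply: sumr_ge0 => p _; apply: mulr_ge0 => //; apply: mulr_ge0.
    exact/ltW/bern_mass_gt0.
  exact: bernoulli_pmf_ge0.
rewrite -(pair_bigA _ (fun y o => w i (y, o) * r i (y, o)))/=.
(* An unobserved edge has ratio [1] and contributes [1 - gamma]; an observed one contributes [gamma]
   times the Bhattacharyya coefficient. *)
have -> : \sum_y \sum_o w i (y, o) * r i (y, o) =
    1 - gamma + gamma * \sum_y Num.sqrt (bern_mass y (a i) * bern_mass y (b i)).
  rewrite !big_bool /= /w /r /= -[in RHS](mulr1 (1 - gamma)).
  rewrite -[X in (1 - gamma) * X](bern_mass_sum (b i)).
  have sqrtE y : bern_mass y (b i) *
      Num.sqrt (bern_mass y (a i) / bern_mass y (b i)) =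
      Num.sqrt (bern_mass y (a i) * bern_mass y (b i)).
    have b0 := bern_mass_gt0 y (b i).
    rewrite -{1}[bern_mass y (b i)]ger0_norm ?(ltW b0)// -sqrtr_sqr.
    rewrite -sqrtrM ?sqr_ge0//; congr Num.sqrt; field; exact: lt0r_neq0.
  by rewrite -!sqrtE; ring.
have := bhattacharyya_le C2 (aC i) (bC i).
set S := \sum_y _; set k := _ / _; set u := (a i - b i) ^+ 2 => Sle.
apply: le_trans (expR_ge1Dx _).
have : gamma * S <= gamma * (1 - k * u) by rewrite ler_wpM2l.
by lra.
Qed.

End FiniteChernoff.

(** * Transfer from the sample space to the finite outcome space *)

Section ObservationLaw.
Context {R : realType} {N K : nat} {d : measure_display} {T : measurableType d}.
Context {P : probability T R} (b : edge N K -> R) (gamma : R).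
Context (Y O : edge N K -> {RV P >-> bool}).
Hypothesis gamma01 : 0 <= gamma <= 1.
Hypothesis hobs : observation_model (fun l => sigmoid (b l)) gamma Y O.

Definition obs w : {ffun edge N K -> bool * bool} := [ffun l => (Y l w, O l w)].

Lemma bernoulli_prob_set1 (p : R) y :
  0 <= p <= 1 -> bernoulli_prob p [set y] = (bernoulli_pmf p y)%:E.
Proof. by move=> p01; rewrite /bernoulli_prob p01 fsbig_set1. Qed.

Lemma obs_law f : measurable (obs @^-1` [set f]) /\
  P (obs @^-1` [set f]) = (obs_mass gamma b f)%:E.
Proof.
pose X (e : edge N K + edge N K) : T -> bool :=
  match e with inl l => Y l | inr l => O l end.
pose B (e : edge N K + edge N K) : set bool :=
  match e with inl l => [set (f l).1] | inr l => [set (f l).2] end.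
(* A fibre prescribes every label and every flag, so it is the intersection over the whole index
   type of the joint independence hypothesis. *)
have -> : obs @^-1` [set f] = \bigcap_(e in [set` [set: edge N K + edge N K]%SET])
    (X e @^-1` B e).
  apply/seteqP; split => w /=.
    by move=> wf [l|l] _ /=; rewrite -wf ffunE.
  move=> h; apply/ffunP => l; rewrite ffunE [RHS]surjective_pairing.
  by congr (_, _); [apply: (h (inl l)) | apply: (h (inr l))]; rewrite /= inE.
split.
  apply: fin_bigcap_measurable => [|e _]; first exact: finite_finset.
  rewrite -[X in measurable X]setTI.
  by case: e => l; exact: measurable_funP.
rewrite (label_observed_indep hobs) => //.
rewrite (eq_bigl predT) => [|e]; last by rewrite inE.
rewrite big_sumType /= /obs_mass big_split /= EFinM -!prodEFin.
have sig01 l : 0 <= sigmoid (b l) <= 1.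
  have := bern_mass_gt0 true (b l); have := bern_mass_gt0 false (b l).
  by rewrite /bern_mass => *; apply/andP; split; lra.
congr (_ * _)%E; apply: eq_bigr => l _.
  rewrite -[LHS]/(distribution P (Y l) [set (f l).1]) (label_law hobs).
  by rewrite bernoulli_prob_set1.
rewrite -[LHS]/(distribution P (O l) [set (f l).2]) (observed_law hobs).
by rewrite bernoulli_prob_set1.
Qed.

(** Covering [A] by finitely many fibres of [obs] suffices; [A] need not be a union of fibres. This
    matters because the estimator may select among several maximizers in a way not determined by the
    data. *)
Lemma obs_event_le (A : set T) (G : pred {ffun edge N K -> bool * bool}) :
  measurable A -> (forall w, A w -> G (obs w)) ->
  (P A <= (\sum_(f | G f) obs_mass gamma b f)%:E)%E.
Proof.
move=> mA AG.
apply: (@le_trans _ _ (\sum_(f \in [set` G]) P (obs @^-1` [set f]))%E).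
  apply: content_sub_fsum => //.
    by move=> f _; have [] := obs_law f.
  by move=> w Aw; exists (obs w) => //; exact: AG.
rewrite (eq_fsbigr (fun f => (obs_mass gamma b f)%:E)); last first.
  by move=> f _; have [] := obs_law f.
rewrite fsbig_finite//= sumEFin lee_fin.
rewrite (perm_big (enum G)) ?big_enum//=.
apply: uniq_perm; rewrite ?finmap.fset_uniq ?enum_uniq// => f.
by rewrite mem_enum in_fset_set//; apply/idP/idP; rewrite inE.
Qed.

End ObservationLaw.

(** * Comparison of the Euclidean norm with the L1 and coordinatewise norms *)

Section EuclideanNorm.
Context {R : realType}.

Lemma coord_le_enorm d (v : 'rV[R]_d) i : `|v 0 i| <= enorm v.
Proof.
rewrite /enorm -sqrtr_sqr ler_wsqrtr// (bigD1 i)//= lerDl.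
by apply: sumr_ge0 => j _; exact: sqr_ge0.
Qed.

Lemma enorm_le_l1norm d (v : 'rV[R]_d) : enorm v <= l1norm v.
Proof.
have l0 : 0 <= l1norm v by exact: sumr_ge0.
rewrite /enorm -[leRHS]ger0_norm// -sqrtr_sqr ler_wsqrtr//.
rewrite expr2 {1}/l1norm mulr_suml; apply: ler_sum => i _.
rewrite -normr_id -[v 0 i ^+ 2]ger0_norm ?sqr_ge0// normrX expr2.
rewrite normr_id ler_wpM2l// /l1norm (bigD1 i)//= lerDl.
exact: sumr_ge0.
Qed.

Lemma l1norm_le d (v : 'rV[R]_d) (e : R) :
  (forall i, `|v 0 i| <= e) -> l1norm v <= e * d%:R.
Proof.
move=> ve; apply: (le_trans (ler_sum _ (fun i _ => ve i))).
by rewrite sumr_const card_ord mulr_natr.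
Qed.

Lemma enorm3_le d1 d2 d3 (u : 'rV[R]_d1 * 'rV[R]_d2 * 'rV[R]_d3) (e : R) :
  (forall i, `|u.1.1 0 i| <= e) -> (forall i, `|u.1.2 0 i| <= e) ->
  (forall i, `|u.2 0 i| <= e) -> enorm3 u <= e * (d1 + d2 + d3)%:R.
Proof.
move=> u1 u2 u3; apply: le_trans (enorm_le_l1norm _) _; apply: l1norm_le => i.
by rewrite mxE; case: splitP => [j _|j _]//; rewrite mxE; case: splitP.
Qed.

Lemma eball_l1norm d (U : R) (v : 'rV[R]_d) : eball U v -> l1norm v <= U * d%:R.
Proof. by move=> vU; apply: l1norm_le => i; apply: le_trans vU; exact: coord_le_enorm. Qed.

End EuclideanNorm.

(** * Rounding of parameters to a grid, and the number of cells *)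

Lemma truncn_eq_dist (R : realType) (x y : R) :
  0 <= x -> 0 <= y -> Num.truncn x = Num.truncn y -> `|x - y| <= 1.
Proof.
move=> /truncn_itv/andP[x1 x2] /truncn_itv/andP[y1 y2] xy.
rewrite xy -natr1 in x1 x2; rewrite -natr1 in y2.
by rewrite ler_norml; apply/andP; split; lra.
Qed.

Lemma sumr_exists_le (R : realType) (I J : finType) (A : J -> pred I) (F : I -> R) :
  (forall i, 0 <= F i) ->
  \sum_(i | [exists j, A j i]) F i <= \sum_j \sum_(i | A j i) F i.
Proof.
move=> F0; rewrite (exchange_big_dep predT)//= [leLHS]big_mkcond/=.
apply: ler_sum => i _; case: existsP => [[j Aji]|_]; last exact: sumr_ge0.
by rewrite (bigD1 j)//= lerDl sumr_ge0.
Qed.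

Section Quantization.
Context {R : realType} {N K dE dR : nat} (U : R).
Hypotheses (N0 : (0 < N)%N) (U0 : 0 < U).
Notation B := (Num.truncn (2 * U * N%:R)).
Implicit Types x : param R N K dE dR.

(** Shifting by [U] makes coordinates of the ball nonnegative, and scaling by [N] gives mesh
    [1 / N]. On the ball the index is at most [B], so [inord] never falls back to its default. *)
Definition cell_index (v : R) : 'I_B.+1 := inord (Num.truncn ((v + U) * N%:R)).

Definition cell x :
    {ffun 'I_N * 'I_dE -> 'I_B.+1} * {ffun 'I_K * 'I_dR -> 'I_B.+1} :=
  ([ffun p => cell_index (x.1 p.1 0 p.2)], [ffun p => cell_index (x.2 p.1 0 p.2)]).

Let N0' : 0 < N%:R :> R. Proof. by rewrite ltr0n. Qed.

Lemma cell_index_mesh (v v' : R) : `|v| <= U -> `|v'| <= U ->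
  cell_index v = cell_index v' -> `|v - v'| <= N%:R^-1.
Proof.
rewrite !ler_norml => /andP[v1 v2] /andP[v1' v2'] /(congr1 val) /=.
have pos u : - U <= u -> 0 <= (u + U) * N%:R by move=> ?; rewrite mulr_ge0//; lra.
have bnd u : - U <= u -> u <= U -> (Num.truncn ((u + U) * N%:R)%R < B.+1)%N.
  move=> u1 u2; rewrite ltnS le_truncn// ler_wpM2r//; lra.
rewrite !inordK ?bnd// => /truncn_eq_dist => /(_ (pos _ v1) (pos _ v1')).
have -> : (v + U) * N%:R - (v' + U) * N%:R = (v - v') * N%:R by ring.
by rewrite normrM [`|N%:R|]ger0_norm// -ler_pdivlMr// mul1r -ler_norml.
Qed.

Lemma eball_coord d (v : 'rV[R]_d) i : eball U v -> `|v 0 i| <= U.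
Proof. by apply: le_trans; exact: coord_le_enorm. Qed.

Lemma cell_mesh x x' l :
  Theta (eball U) (eball U) x -> Theta (eball U) (eball U) x' ->
  cell x = cell x' ->
  enorm3 (coord x l - coord x' l) <= N%:R^-1 * (dE + dE + dR)%:R.
Proof.
move=> [x1 x2] [x1' x2'] [/ffunP e1 /ffunP e2].
apply: enorm3_le => i; rewrite /= !mxE; apply: cell_index_mesh;
  try exact: eball_coord.
- by have := e1 (l.1.1, i); rewrite !ffunE.
- by have := e1 (l.1.2, i); rewrite !ffunE.
- by have := e2 (l.2, i); rewrite !ffunE.
Qed.

Lemma card_cells : #|{: {ffun 'I_N * 'I_dE -> 'I_B.+1} *
                       {ffun 'I_K * 'I_dR -> 'I_B.+1}}| =
  (B.+1 ^ (N * dE + K * dR))%N.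
Proof. by rewrite card_prod !card_ffun !card_prod !card_ord expnD. Qed.

(** Each coordinate has [B + 1 <= N * (1 + 2 * U) <= N * expR (2 * U)] possible indices. *)
Lemma card_cells_le : #|{: {ffun 'I_N * 'I_dE -> 'I_B.+1} *
                       {ffun 'I_K * 'I_dR -> 'I_B.+1}}|%:R <=
  expR ((N * dE + K * dR)%:R * (ln N%:R + 2 * U)).
Proof.
rewrite card_cells natrX expRM_natl lerXn2r ?nnegrE ?expR_ge0 ?ler0n//.
rewrite expRD lnK ?posrE//.
have : B%:R <= 2 * U * N%:R by rewrite truncn_le !mulr_ge0// ltW.
have : 1 <= N%:R :> R by rewrite ler1n.
have := expR_ge1Dx (2 * U).
rewrite -natr1; nra.
Qed.

End Quantization.

(** * Effect of rounding and of the penalty on likelihood and loss *)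

Section Model.
Context {R : realType} {N K dE dR : nat}.
Context (phi : 'rV[R]_dE * 'rV[R]_dE * 'rV[R]_dR -> R).
Implicit Types (x : param R N K dE dR).

Definition scores x (l : edge N K) : R := phi (coord x l).

Lemma loglik_obs (y o : edge N K -> bool) x :
  loglik phi y (observed_set o) x =
  obs_loglik (scores x) [ffun l => (y l, o l)].
Proof.
rewrite /loglik /obs_loglik; apply: eq_big => [l|l _]; first by rewrite ffunE inE.
rewrite ffunE /edge_prob -/(scores x l) /bern_mass /=.
by case: (y l); rewrite /= ?subrr ?subr0 !mul1r mul0r ?addr0 ?add0r.
Qed.

(** Every observed edge moves by at most [e]; counting all edges makes the bound uniform in the
    outcome [f]. *)
Lemma obs_loglik_lipschitz (a b : edge N K -> R) (e : R) f : 0 <= e ->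
  (forall l, `|a l - b l| <= e) ->
  obs_loglik a f - e * (N * N * K)%:R <= obs_loglik b f.
Proof.
move=> e0 ab; rewrite lerBlDr -lerBlDl /obs_loglik -sumrB.
apply: (@le_trans _ _ (\sum_(l : edge N K) e)).
  rewrite [leLHS]big_mkcond; apply: ler_sum => l _; case: ifP => // _.
  exact: le_trans (ler_norm _) (le_trans (ln_bern_mass_lipschitz _ _ _) (ab l)).
by rewrite sumr_const !card_prod !card_ord mulr_natr.
Qed.

Context (U C : R).
Hypothesis N0 : (0 < N)%N.
Hypothesis U0 : 0 < U.
Hypothesis phiC : forall u, (eball U `*` eball U `*` eball U) u -> `|phi u| <= C.

Lemma Theta_coord x l : Theta (eball U) (eball U) x ->
  (eball U `*` eball U `*` eball U) (coord x l).
Proof. by move=> [x1 x2]; split; [split; exact: x1|exact: x2]. Qed.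

Lemma scores_le x l : Theta (eball U) (eball U) x -> `|scores x l| <= C.
Proof. by move=> xT; exact/phiC/Theta_coord. Qed.

(** A difference of two squares factors, with one factor at most [4 * C] and the other at most
    [e]. *)
Lemma sum_sqr_dist_le (a a' b : edge N K -> R) (e : R) :
  (forall l, `|a l| <= C) -> (forall l, `|a' l| <= C) ->
  (forall l, `|b l| <= C) -> (forall l, `|a l - a' l| <= e) ->
  \sum_l (a l - b l) ^+ 2 - 4 * C * e * (N * N * K)%:R <=
  \sum_l (a' l - b l) ^+ 2.
Proof.
move=> aC a'C bC aa'.
rewrite lerBlDr -lerBlDl -sumrB.
apply: (@le_trans _ _ (\sum_(l : edge N K) 4 * C * e)); last first.
  by rewrite sumr_const !card_prod !card_ord mulr_natr.
apply: ler_sum => l _.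
have -> : (a l - b l) ^+ 2 - (a' l - b l) ^+ 2 =
  (a l + a' l - b l - b l) * (a l - a' l) by ring.
apply: (le_trans (ler_norm _)); rewrite normrM; apply: ler_pM => //.
move: (aC l) (a'C l) (bC l); rewrite !ler_norml.
by move=> /andP[? ?] /andP[? ?] /andP[? ?]; apply/andP; split; lra.
Qed.

Lemma param_l1norm_ge0 x : 0 <= param_l1norm x.
Proof.
by rewrite /param_l1norm addr_ge0//; apply: sumr_ge0 => i _; exact: sumr_ge0.
Qed.

(** The growth is linear in [N], which makes the penalty negligible against [m log N] when
    [rho1 + rho2 = o(log N)]. *)
Lemma penalty_le (rho1 rho2 : R) x : 0 <= rho1 -> 0 <= rho2 ->
  Theta (eball U) (eball U) x ->
  rho1 * param_l1norm x + rho2 * param_enorm x ^+ 2 <=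
  (rho1 + rho2) * N%:R * (U * (dE + K * dR)%:R + U ^+ 2 * (1 + K)%:R).
Proof.
move=> r1 r2 [x1 x2].
have N1 : 1 <= N%:R :> R by rewrite ler1n.
have sumE k (c : R) : \sum_(i < k) c = k%:R * c.
  by rewrite sumr_const card_ord mulr_natl.
have l1 : param_l1norm x <= N%:R * (U * (dE + K * dR)%:R).
  apply: (@le_trans _ _ (\sum_(i < N) U * dE%:R + \sum_(k < K) U * dR%:R)).
    by apply: lerD; apply: ler_sum => i _; exact: eball_l1norm.
  rewrite !sumE natrD natrM mulrDr [leRHS]mulrDr.
  have : 0 <= K%:R * dR%:R * U by rewrite !mulr_ge0// ltW.
  nra.
have l2 : param_enorm x ^+ 2 <= N%:R * (U ^+ 2 * (1 + K)%:R).
  have sq d (v : 'rV[R]_d) : eball U v -> enorm v ^+ 2 <= U ^+ 2.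
    by move=> vU; rewrite lerXn2r ?nnegrE ?sqrtr_ge0 ?(ltW U0).
  rewrite /param_enorm sqr_sqrtr; last first.
    by rewrite addr_ge0//; apply: sumr_ge0 => i _; exact: sqr_ge0.
  apply: (@le_trans _ _ (\sum_(i < N) U ^+ 2 + \sum_(k < K) U ^+ 2)).
    by apply: lerD; apply: ler_sum => i _; exact: sq.
  rewrite !sumE natrD mulrDr [leRHS]mulrDr.
  have : 0 <= K%:R * U ^+ 2 by rewrite mulr_ge0// sqr_ge0.
  nra.
have U1 : 0 <= N%:R * (U * (dE + K * dR)%:R) by rewrite !mulr_ge0 ?(ltW U0).
have U2 : 0 <= N%:R * (U ^+ 2 * (1 + K)%:R) by rewrite !mulr_ge0 ?(ltW U0).
have := ler_wpM2l r1 l1; have := ler_wpM2l r2 l2.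
have := mulr_ge0 r1 U2; have := mulr_ge0 r2 U1.
rewrite -mulrA mulrDr; nra.
Qed.

End Model.

(** * Tail bound for the loss at fixed [N], uniform in the threshold *)

Section TailBound.
Context {R : realType} {N K dE dR : nat}.
Context (phi : 'rV[R]_dE * 'rV[R]_dE * 'rV[R]_dR -> R).
Context (U C alpha gamma rho1 rho2 : R).
Hypothesis (N0 : (0 < N)%N) (K0 : (0 < K)%N) (U0 : 0 < U).
Hypotheses (gamma01 : 0 < gamma <= 1) (C2 : 2 <= C).
Hypothesis phiC : forall u, (eball U `*` eball U `*` eball U) u -> `|phi u| <= C.
Hypothesis hlip : score_lipschitz phi (eball U) (eball U) alpha.
Hypotheses (r1 : 0 <= rho1) (r2 : 0 <= rho2).
Context (xstar : param R N K dE dR).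
Hypothesis hxstar : Theta (eball U) (eball U) xstar.
Context {d : measure_display} {T : measurableType d} {P : probability T R}.
Context (Y O : edge N K -> {RV P >-> bool}).
Hypothesis hobs : observation_model (edge_prob phi xstar) gamma Y O.
Context (xhat : T -> param R N K dE dR).
Hypothesis hxhat : forall w,
  is_penalized_mle phi (eball U) (eball U) rho1 rho2
    (fun l => Y l w) (observed_set (fun l => O l w)) (xhat w).
Hypothesis hmeas : measurable_fun [set: T] (fun w => MSE phi (xhat w) xstar).

(* The union bound runs over one representative in [Theta] of each cell. *)
Let rep c : param R N K dE dR :=
  xget xstar [set x | Theta (eball U) (eball U) x /\ cell U x = c].

Let rep_Theta c : Theta (eball U) (eball U) (rep c).
(* A cell that misses [Theta] receives the default [xstar], which lies in [Theta]. *)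
Proof. by rewrite /rep; case: xgetP => [x _ []|]. Qed.

Let rep_cell x : Theta (eball U) (eball U) x -> cell U (rep (cell U x)) = cell U x.
Proof.
move=> xT; rewrite /rep; case: xgetP => [x' _ [] //|/(_ x)].
by move=> /not_andP[|].
Qed.

Let D : R := `|alpha| * (dE + dE + dR)%:R.
Let pen : R := U * (dE + K * dR)%:R + U ^+ 2 * (1 + K)%:R.
Let kappa : R := sigmoid C * (1 - sigmoid C) / (10 * C).

(** The four summands pay for the count of cells, the rounding of the likelihood, the penalty at
    [xstar], and the rounding of the squared error. *)
Definition tail_const : R :=
  (dE + K * dR)%:R * (2 * U) + K%:R * D / 2 + pen / 2 +
  gamma * kappa * (4 * C * D * K%:R).

Let kappa_ge0 : 0 <= kappa.
Proof.
apply: divr_ge0; first exact/ltW/sigmoid_prod_gt0.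
by rewrite mulr_ge0//; move: C2; lra.
Qed.

Let D_ge0 : 0 <= D. Proof. by rewrite mulr_ge0. Qed.

Let pen_ge0 : 0 <= pen.
Proof. by rewrite addr_ge0 ?mulr_ge0 ?sqr_ge0 ?(ltW U0). Qed.

Lemma tail_const_ge0 : 0 <= tail_const.
Proof.
have C0 : 0 <= C by move: C2; lra.
have g0 : 0 <= gamma by case/andP: gamma01 => /ltW.
have U0' := ltW U0.
move: kappa_ge0; rewrite /tail_const; move: kappa => k k0.
by rewrite !addr_ge0 ?divr_ge0 ?mulr_ge0.
Qed.

Lemma scores_rep_dist x l : Theta (eball U) (eball U) x ->
  `|scores phi x l - scores phi (rep (cell U x)) l| <= D / N%:R.
Proof.
move=> xT; set x' := rep _.
have x'T : Theta (eball U) (eball U) x' := rep_Theta _.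
apply: (le_trans (hlip (Theta_coord l xT) (Theta_coord l x'T))).
have e0 : 0 <= enorm3 (coord x l - coord x' l) := sqrtr_ge0 _.
apply: (le_trans (ler_wpM2r e0 (ler_norm alpha))).
rewrite /D -mulrA ler_wpM2l// mulrC; apply: (cell_mesh N0 l xT x'T).
by rewrite rep_cell.
Qed.

Lemma mse_tail_bound (t : R) :
  (P [set w | t <= MSE phi (xhat w) xstar]%R <=
   (expR (num_params dE dR K N * ln N%:R +
          tail_const * N%:R * (1 + (rho1 + rho2)) -
          kappa * t * eff_size gamma K N))%:E)%E.
Proof.
have N0' : 0 < N%:R :> R by rewrite ltr0n.
have gam01 : 0 <= gamma <= 1 by case/andP: gamma01 => /ltW ->.
(* [delta] is the likelihood lost by rounding [xhat] plus the bound on the penalty of [xstar]; the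
   penalty of [xhat] is nonnegative and is dropped. [t'] is the total squared error that survives
   rounding. *)
pose delta : R := D / N%:R * (N * N * K)%:R + (rho1 + rho2) * N%:R * pen.
pose t' : R := t * (N * N * K)%:R - 4 * C * (D / N%:R) * (N * N * K)%:R.
pose sqdist c := \sum_l (scores phi (rep c) l - scores phi xstar l) ^+ 2.
pose A c (f : {ffun edge N K -> bool * bool}) := (t' <= sqdist c) &&
  (obs_loglik (scores phi xstar) f - delta <= obs_loglik (scores phi (rep c)) f).
apply: (@le_trans _ _ (\sum_(f | [exists c, A c f])
    obs_mass gamma (scores phi xstar) f)%:E).
  apply: (obs_event_le gam01 hobs).
    have := hmeas measurableT (measurable_itv `[t, +oo[).
    rewrite setTI; congr (measurable _); apply/seteqP; split => w /=;
    by rewrite in_itv/= andbT.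
  move=> w /= tw; have [xT opt] := hxhat w.
  have near l := scores_rep_dist l xT.
  apply/existsP; exists (cell U (xhat w)); apply/andP; split.
    have sl (x : param R N K dE dR) : Theta (eball U) (eball U) x -> forall l, `|scores phi x l| <= C.
      by move=> xT' l; exact: (scores_le phiC l xT').
    have := sum_sqr_dist_le (sl _ xT) (sl _ (rep_Theta _)) (sl _ hxstar) near.
    apply: le_trans.
    rewrite lerD2r.
    by move: tw; rewrite /MSE !card_prod !card_ord ler_pdivlMr// ltr0n !muln_gt0 N0 K0.
  have := opt _ hxstar; rewrite /penalized_loglik !loglik_obs -/(obs Y O w).
  have := penalty_le N0 U0 r1 r2 hxstar; rewrite -/pen.
  have e0 : 0 <= D / N%:R by rewrite divr_ge0.
  have := obs_loglik_lipschitz (obs Y O w) e0 near.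
  have : 0 <= rho1 * param_l1norm (xhat w) by rewrite mulr_ge0 ?param_l1norm_ge0.
  have : 0 <= rho2 * param_enorm (xhat w) ^+ 2 by rewrite mulr_ge0 ?sqr_ge0.
  rewrite /delta; lra.
rewrite lee_fin; apply: le_trans (sumr_exists_le _ _) _ => [f|].
  exact: obs_mass_ge0.
apply: (@le_trans _ _ (\sum_(c : {: {ffun 'I_N * 'I_dE -> _} *
    {ffun 'I_K * 'I_dR -> _}}) expR (delta / 2 - gamma * kappa * t'))).
  apply: ler_sum => c _; rewrite /A; case: (leP t' (sqdist c)) => tc; last first.
    by rewrite big_pred0 ?expR_ge0.
  apply: le_trans (loglik_ratio_chernoff _ C2 gam01 _ _) _ => [l|l|].
  - exact: (scores_le phiC l (rep_Theta c)).
  - exact: (scores_le phiC l hxstar).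
  rewrite ler_expR lerD2l lerN2 -/kappa; apply: ler_wpM2l => //.
  by apply: (mulr_ge0 _ kappa_ge0); case/andP: gam01.
rewrite sumr_const -[leLHS]mulr_natl.
apply: (le_trans (ler_wpM2r (expR_ge0 _) (card_cells_le N0 U0 ))).
rewrite -expRD ler_expR /num_params /eff_size.
have ME : (N * dE + K * dR)%:R * (2 * U) <= N%:R * ((dE + K * dR)%:R * (2 * U)).
  rewrite [leRHS]mulrA -natrM ler_wpM2r ?mulr_ge0 ?(ltW U0)// ler_nat mulnDr leq_add2l.
  by rewrite leq_pmull.
have deltaE : delta = N%:R * (K%:R * D) + (rho1 + rho2) * N%:R * pen.
  by rewrite /delta !natrM; field; exact: lt0r_neq0.
have t'E : t' = t * (N%:R ^+ 2 * K%:R) - N%:R * (4 * C * D * K%:R).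
  by rewrite /t' !natrM; field; exact: lt0r_neq0.
rewrite deltaE t'E /tail_const.
have C0 : 0 <= C by move: C2; lra.
have g0 : 0 <= gamma by case/andP: gam01.
have U0' := ltW U0.
move: ME (ler0n R (dE + K * dR)) kappa_ge0 D_ge0 pen_ge0.
move: kappa D pen (dE + K * dR)%:R => kap D' pen' E' ME E0 kap0 D0 pen0.
(* The bound multiplies all of [tail_const] by [1 + (rho1 + rho2)]; this term and the next are the
   resulting surplus. *)
have : 0 <= N%:R * (rho1 + rho2) * (E' * (2 * U) + K%:R * D' / 2 +
    gamma * kap * (4 * C * D' * K%:R)) by rewrite ?(mulr_ge0, addr_ge0, divr_ge0).
have : 0 <= N%:R * (pen' / 2) by rewrite ?(mulr_ge0, divr_ge0).
move: ME; rewrite /num_params; lra.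
Qed.

End TailBound.
Arguments tail_const {R} K dE dR U C alpha gamma.

(** [sup] is [0] on a set without supremum, so a positive value certifies that the scores are
    bounded. *)
Lemma score_sup_ge (R : realType) (dE dR : nat)
    (phi : 'rV[R]_dE * 'rV[R]_dE * 'rV[R]_dR -> R) E W u :
  0 < score_sup phi E W -> (E `*` E `*` W) u -> `|phi u| <= score_sup phi E W.
Proof.
rewrite /score_sup => sup0 uEW.
have [hs|/sup_out s0] := pselect (has_sup [set `|phi u| | u in E `*` E `*` W]).
  by apply: ub_le_sup; [case: hs|exists u].
by move: sup0; rewrite s0 ltxx.
Qed.

(** * Criteria for the asymptotic comparisons, and growth of [n / m] *)

Section Asymptotics.
Context {R : realType}.

Lemma limn_einf_ge1 (u : nat -> \bar R) :
  (forall e : R, 0 < e -> \forall N \near \oo, ((1 - e)%:E <= u N)%E) ->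
  (1 <= limn_einf u)%E.
Proof.
move=> h; apply/lee_subgt0Pr => e e0; rewrite -EFinB limn_einf_lim.
apply: lime_ge; first exact: is_cvg_einfs.
have [M _ hM] := h e e0; exists M => // n /= Mn.
by apply: le_ereal_inf_tmp => _ [k /= nk <-]; apply: hM; exact: leq_trans nk.
Qed.

Lemma limn_esup_le1 (u : nat -> \bar R) :
  (forall e : R, 0 < e -> \forall N \near \oo, (u N <= (1 + e)%:E)%E) ->
  (limn_esup u <= 1)%E.
Proof.
move=> h; apply/lee_addgt0Pr => e e0; rewrite -EFinD limn_esup_lim.
apply: lime_le; first exact: is_cvg_esups.
have [M _ hM] := h e e0; exists M => // n /= Mn.
by apply: ge_ereal_sup => _ [k /= nk <-]; apply: hM; exact: leq_trans nk.
Qed.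

(** Dividing by the negative [b N] reverses the order, so an upper bound on [p] suffices.
    Monotonicity of [lne] also covers [p N = 0]. *)
Lemma lesssim_neg_lne (p : nat -> \bar R) (b : nat -> R) :
  (forall N, (0 <= p N)%E) -> (\forall N \near \oo, b N < 0) ->
  (forall e, 0 < e -> \forall N \near \oo, (p N <= (expR ((1 - e) * b N))%:E)%E) ->
  lesssim_neg (fun N => lne (p N)) b.
Proof.
move=> p0 b0 h; apply: limn_einf_ge1 => e e0; near=> N.
have bN : b N < 0 by near: N.
rewrite inver lt_eqF// lee_ndivlMr// -EFinM.
rewrite -[X in (_ <= X%:E)%E]expRK -lne_EFin ?expR_gt0//.
by rewrite lee_lne ?in_itv/= ?p0 ?leey ?lee_fin ?expR_ge0//; near: N; exact: h.
Unshelve. all: by end_near. Qed.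

Lemma lesssim_pos_bound (a : nat -> \bar R) (b : nat -> R) :
  (\forall N \near \oo, 0 < b N) ->
  (forall e, 0 < e -> \forall N \near \oo, (a N <= ((1 + e) * b N)%:E)%E) ->
  lesssim_pos a b.
Proof.
move=> b0 h; apply: limn_esup_le1 => e e0; near=> N.
have bN : 0 < b N by near: N.
rewrite inver gt_eqF// lee_pdivrMr// -EFinM.
by near: N; exact: h.
Unshelve. all: by end_near. Qed.

Lemma near_ln_ge (A : R) : \forall N \near \oo, A <= ln N%:R.
Proof.
near=> N.
have AN : expR A <= N%:R by near: N; exact: nbhs_infty_ger.
by rewrite -[A]expRK ler_ln ?posrE ?expR_gt0// (lt_le_trans _ AN)// expR_gt0.
Unshelve. all: by end_near. Qed.

(** [ln z = 2 * ln (sqrt z) <= 2 * sqrt z], and the assumption says [2 <= e * sqrt z]. *)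
Lemma ln_le_mul (e z : R) : 0 < e -> (2 / e) ^+ 2 <= z -> ln z <= e * z.
Proof.
move=> e0 ez; have z0 : 0 < z by apply: lt_le_trans ez; rewrite exprn_gt0 ?divr_gt0.
have y0 : 0 < Num.sqrt z by rewrite sqrtr_gt0.
have ey : 2 / e <= Num.sqrt z.
  by rewrite -[leLHS]ger0_norm ?divr_ge0 ?(ltW e0)// -sqrtr_sqr ler_wsqrtr.
rewrite -[z]sqr_sqrtr ?(ltW z0)// lnXn//.
have := ln_sublinear y0; move: ey; rewrite ler_pdivrMr// => ey ly.
move: (Num.sqrt z) (ln _) y0 ey ly => y l *; nra.
Qed.

Section SampleRatio.
Context (gamma : R) (K dE dR : nat).
Hypotheses (K0 : (0 < K)%N) (dE0 : (0 < dE)%N) (gamma0 : 0 < gamma).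
Local Notation n := (eff_size gamma K).
Local Notation m := (num_params (R := R) dE dR K).
Local Notation z N := (n N / m N).

Lemma num_params_ge N : N%:R <= m N.
Proof. by rewrite ler_nat (leq_trans _ (leq_addr _ _))// leq_pmulr. Qed.

Lemma num_params_gt0 N : (0 < N)%N -> 0 < m N.
Proof. by move=> N0; apply: lt_le_trans (num_params_ge N); rewrite ltr0n. Qed.

Lemma eff_size_gt0 N : (0 < N)%N -> 0 < n N.
Proof. by move=> N0; rewrite !mulr_gt0 ?exprn_gt0 ?ltr0n. Qed.

Let c0 : R := gamma * K%:R / (dE + K * dR)%:R.

Let c0_gt0 : 0 < c0.
Proof. by rewrite divr_gt0 ?mulr_gt0 ?ltr0n// ltn_addr. Qed.

Lemma ratio_ge N : (0 < N)%N -> c0 * N%:R <= z N.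
Proof.
move=> N0; rewrite ler_pdivlMr ?num_params_gt0// /num_params.
have E0 : 0 < (dE + K * dR)%:R :> R by rewrite ltr0n ltn_addr.
apply: (@le_trans _ _ (c0 * N%:R * (N * (dE + K * dR))%:R)).
  apply: ler_wpM2l; first exact: (mulr_ge0 (ltW c0_gt0)).
  rewrite ler_nat mulnDr leq_add2l.
  by rewrite leq_pmull.
rewrite le_eqVlt; apply/orP; left; apply/eqP.
rewrite /c0 /eff_size natrM; move: (dE + K * dR)%:R E0 => E E0.
by field; exact: lt0r_neq0.
Qed.

Lemma near_ratio_ge (A : R) : \forall N \near \oo, A <= z N.
Proof.
near=> N; apply: le_trans (ratio_ge _); last by near: N; exists 1%N.
by rewrite -ler_pdivrMl//; near: N; exact: nbhs_infty_ger.
Unshelve. all: by end_near. Qed.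

Lemma near_ln_le_ln_ratio (e : R) : 0 < e ->
  \forall N \near \oo, ln N%:R <= (1 + e) * ln (z N).
Proof.
move=> e0; near=> N.
have N0 : (0 < N)%N by near: N; exists 1%N.
have N0' : 0 < N%:R :> R by rewrite ltr0n.
have lz : ln c0 + ln N%:R <= ln (z N).
  have z0 : 0 < z N by rewrite divr_gt0 ?num_params_gt0 ?eff_size_gt0.
  have cN : 0 < c0 * N%:R := mulr_gt0 c0_gt0 N0'.
  by rewrite -lnM ?posrE// ler_ln ?posrE// ratio_ge.
(* The threshold past which [e * ln N] absorbs the constant [(1 + e) * ln c0]. *)
have : - (1 + e) * ln c0 / e <= ln N%:R by near: N; exact: near_ln_ge.
rewrite ler_pdivrMr//; nra.
Unshelve. all: by end_near. Qed.

End SampleRatio.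

End Asymptotics.

(** * Range of the loss, and expectation from the tail *)

Section MSE.
Context {R : realType} {N K dE dR : nat}.
Context (phi : 'rV[R]_dE * 'rV[R]_dE * 'rV[R]_dR -> R) (U C : R).
Hypothesis phiC : forall u, (eball U `*` eball U `*` eball U) u -> `|phi u| <= C.
Implicit Types x : param R N K dE dR.

Lemma MSE_ge0 x x' : 0 <= MSE phi x x'.
Proof. by rewrite divr_ge0//; apply: sumr_ge0 => l _; exact: sqr_ge0. Qed.

Lemma MSE_le x x' : Theta (eball U) (eball U) x -> Theta (eball U) (eball U) x' ->
  MSE phi x x' <= (2 * C) ^+ 2.
Proof.
move=> xT x'T; rewrite /MSE.
(* Without edges the average is [0], by the convention that [0] has inverse [0]. *)
have [->|/eqP N0] := eqVneq #|edge N K| 0%N.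
  by rewrite invr0 mulr0 sqr_ge0.
rewrite ler_pdivrMr ?ltr0n ?lt0n//; last exact/eqP.
rewrite mulr_natr -sumr_const; apply: ler_sum => l _.
rewrite -real_normK ?num_real//.
have xC := scores_le phiC l xT; have x'C := scores_le phiC l x'T.
have C0 : 0 <= C := le_trans (normr_ge0 _) xC.
rewrite lerXn2r ?nnegrE ?mulr_ge0//; apply: le_trans (ler_normB _ _) _.
by move: xC x'C; rewrite /scores; lra.
Qed.

End MSE.

(** Integrates the pointwise bound of [X] by [t] plus [M] times the indicator of the tail event. *)
Lemma expectation_le_tail (R : realType) (d : measure_display)
    (T : measurableType d) (P : probability T R) (X : T -> R) (t M : R) :
  measurable_fun [set: T] X -> 0 <= t -> 0 <= M -> (forall w, 0 <= X w <= M) ->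
  ('E_P[X] <= t%:E + M%:E * P [set w | (t <= X w)%R])%E.
Proof.
move=> mX t0 M0 XM; set A := [set w | _].
have mA : measurable A.
  have := mX measurableT _ (measurable_itv `[t, +oo[).
  rewrite setTI; congr (measurable _); apply/seteqP; split => w /=;
  by rewrite in_itv/= andbT.
have mY : measurable_fun [set: T] (fun w => t + M * \1_A w).
  by apply: measurable_funD => //; apply: measurable_funM.
apply: (@le_trans _ _ ('E_P[fun w => (t + M * \1_A w)%R])%E).
  apply: expectation_le => //.
  - by move=> w; have /andP[] := XM w.
  - by move=> w; rewrite addr_ge0 ?mulr_ge0.
  - apply: aeW => w; have /andP[X0 XM'] := XM w.
    rewrite indicE; case: (boolP (w \in A)) => [|/negP wA].
      by rewrite mulr1; lra.
    rewrite mulr0 addr0 ltW// ltNge; apply/negP => tw.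
    by apply: wA; rewrite inE.
rewrite unlock; under eq_integral do rewrite EFinD EFinM.
rewrite ge0_integralD//=.
- rewrite integral_cst//= probability_setT mule1 leeD2l//.
  rewrite ge0_integralZl_EFin//.
    by rewrite integral_indic// setIT.
  by apply/measurable_EFinP; exact: measurable_indic.
- by move=> w _; rewrite -EFinM lee_fin mulr_ge0.
- under eq_fun do rewrite -EFinM; apply/measurable_EFinP.
  apply: measurable_funM => //; exact: measurable_indic.
Qed.

(** * Asymptotics of the tail bound and the three conclusions *)

Theorem corollary1 (R : realType) (K dE dR : nat) (C U alpha gamma : R)
  (hK : (0 < K)%N) (hdE : (0 < dE)%N) (hdR : (0 < dR)%N)
  (hU : 0 < U) (hgamma : 0 < gamma <= 1) (hC2 : 2 <= C)
  (phi : nat -> 'rV[R]_dE * 'rV[R]_dE * 'rV[R]_dR -> R)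
  (hC : forall N, C = score_sup (phi N) (eball U) (eball U))
  (hlip : forall N, score_lipschitz (phi N) (eball U) (eball U) alpha)
  (rho1 rho2 : nat -> R)
  (hrho1 : forall N, 0 <= rho1 N) (hrho2 : forall N, 0 <= rho2 N)
  (hrho : (fun N => rho1 N + rho2 N : R^o) =o_\oo (fun N => ln N%:R : R^o))
  (xstar : forall N, param R N K dE dR)
  (hxstar : forall N, Theta (eball U) (eball U) (xstar N))
  (d : nat -> measure_display) (T : forall N, measurableType (d N))
  (P : forall N, probability (T N) R)
  (Y O : forall N, edge N K -> {RV (P N) >-> bool})
  (hobs : forall N,
     observation_model (edge_prob (phi N) (xstar N)) gamma (Y N) (O N))
  (xhat : forall N, T N -> param R N K dE dR)
  (hxhat : forall N w,
     is_penalized_mle (phi N) (eball U) (eball U) (rho1 N) (rho2 N)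
       (fun l => Y N l w) (observed_set (fun l => O N l w)) (xhat N w))
  (hmeas : forall N,
     measurable_fun [set: T N] (fun w => MSE (phi N) (xhat N w) (xstar N))) :
  let n := eff_size gamma K in
  let m := num_params (R := R) dE dR K in
  let mse N w := MSE (phi N) (xhat N w) (xstar N) in
  let s := sigmoid C * (1 - sigmoid C) in
  [/\ forall t : R, 0 < t ->
        lesssim_neg (fun N => lne (P N [set w | t <= mse N w]))
                    (fun N => - (s * t / (10 * C)) * n N),
      let t N := 20 * C / s * (m N / n N) * ln (n N / m N) in
        lesssim_neg (fun N => lne (P N [set w | t N <= mse N w]))
                    (fun N => - m N * ln (n N / m N))
    & lesssim_pos (fun N => ('E_(P N)[mse N])%E)
                  (fun N => 20 * C / s * (m N / n N) * ln (n N / m N))].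
Proof.
have s0 : 0 < sigmoid C * (1 - sigmoid C) := sigmoid_prod_gt0 C.
have C0 : 0 < C by lra.
have g0 : 0 < gamma by case/andP: hgamma.
have phiC N u : (eball U `*` eball U `*` eball U) u -> `|phi N u| <= C.
  by rewrite [C](hC N); apply: score_sup_ge; rewrite -hC.
move=> n m mse s.
pose kappa := s / (10 * C).
have kappa0 : 0 < kappa by rewrite divr_gt0// mulr_gt0.
have kappaE t : s * t / (10 * C) = kappa * t.
  by rewrite /kappa; field; exact: lt0r_neq0.
pose c := tail_const K dE dR U C alpha gamma.
have c0 : 0 <= c by exact: tail_const_ge0.
have n0 N : (0 < N)%N -> 0 < n N by exact: eff_size_gt0.
have m0 N : (0 < N)%N -> 0 < m N by exact: num_params_gt0.
have near_ratio A := @near_ratio_ge R gamma K dE dR hK hdE g0 A.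
have near_pos : \forall N \near \oo, (0 < N)%N by exists 1%N.
pose tail_le e N := forall t, (P N [set w | t <= mse N w]%R <=
  (expR ((1 + e) * (m N * ln (n N / m N)) - kappa * t * n N))%:E)%E.
have tail e : 0 < e -> \forall N \near \oo, tail_le e N.
  (* The choice of [e'] ensures [(1 + e') ^ 2 <= 1 + 3 * e' <= 1 + e]. Below, [q] is such that
     [c * (1 + rho1 + rho2) <= e' * ln N] once [1] and [rho1 + rho2] are both at most [q * ln N]. *)
  move=> e0; pose e' := Num.min 1 (e / 3).
  have e'0 : 0 < e' by rewrite lt_min ltr01 divr_gt0.
  have e'1 : e' <= 1 by rewrite ge_min lexx.
  have e'3 : 3 * e' <= e.
    have : e' <= e / 3 by rewrite ge_min lexx orbT.
    by lra.
  pose q := e' / (2 * (c + 1)).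
  have q0 : 0 < q by rewrite divr_gt0// mulr_gt0//; lra.
  near=> N => t.
  have N0 : (0 < N)%N by near: N.
  apply: le_trans (mse_tail_bound N0 hK hU hgamma hC2 (phiC N) (hlip N) (hrho1 N)
    (hrho2 N) (hxstar N) (hobs N) (hxhat N) (hmeas N) t) _.
  rewrite lee_fin ler_expR lerD2r -/c -/(m N).
  have l1 : 1 <= q * ln N%:R.
    by rewrite -ler_pdivrMl// mulr1; near: N; exact: near_ln_ge.
  have l0 : 0 < ln (N%:R : R) by rewrite -(pmulr_rgt0 _ q0); apply: lt_le_trans l1.
  have r1 : rho1 N + rho2 N <= q * ln N%:R.
    rewrite -[leLHS]ger0_norm ?addr_ge0// -[ln _]gtr0_norm//.
    by near: N; move/eqoP : hrho; apply.
  have lz : ln N%:R <= (1 + e') * ln (n N / m N).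
    by near: N; exact: near_ln_le_ln_ratio.
  have qc : c * (1 + (rho1 N + rho2 N)) <= e' * ln N%:R.
    have : e' = q * (2 * (c + 1)) by rewrite /q; field; apply/lt0r_neq0; lra.
    move=> ->; nra.
  have Nm : N%:R <= m N := @num_params_ge R K dE dR hdE N.
  have mN := m0 _ N0.
  have z0 : 0 <= ln (n N / m N).
    have : 0 < (1 + e') * ln (n N / m N) by apply: lt_le_trans lz.
    by rewrite pmulr_rgt0; [exact: ltW|lra].
  (* One factor [1 + e'] absorbs the error term, using [N <= m]; a second one replaces [ln N] by
     [ln (n / m)]. *)
  apply: (@le_trans _ _ ((1 + e') * (m N * ln N%:R))).
    have : N%:R * (c * (1 + (rho1 N + rho2 N))) <= m N * (e' * ln N%:R).
      apply: ler_pM => //; apply: mulr_ge0 => //.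
      by rewrite !addr_ge0.
    by lra.
  rewrite mulrCA [leRHS]mulrCA ler_pM2l//.
  apply: (@le_trans _ _ ((1 + e') * ((1 + e') * ln (n N / m N)))).
    by rewrite ler_wpM2l//; lra.
  by rewrite mulrA ler_wpM2r//; nra.
pose tN N := 20 * C / s * (m N / n N) * ln (n N / m N).
(* The constant [20 * C / s] makes the gain twice the entropy term, so the tail exponent becomes
   [(1 + e) - 2 = - (1 - e)] times [m * ln (n / m)]. *)
have tNE N : (0 < N)%N -> kappa * tN N * n N = 2 * (m N * ln (n N / m N)).
  move=> N0; rewrite /tN /kappa; move: (ln _) => l; field.
  by rewrite !lt0r_neq0 ?n0 ?m0.
have lnz_ge1 : \forall N \near \oo, 1 <= ln (n N / m N).
  near=> N; rewrite -[leLHS]expRK ler_ln ?posrE ?expR_gt0//.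
    by near: N; exact: near_ratio.
  by rewrite divr_gt0 ?n0 ?m0//; near: N.
have tailN e : 0 < e -> \forall N \near \oo,
    (P N [set w | tN N <= mse N w]%R <=
     (expR ((1 - e) * (- m N * ln (n N / m N))))%:E)%E.
  move=> e0; near=> N.
  have N0 : (0 < N)%N by near: N.
  have tailN : tail_le e N by near: N; exact: tail.
  apply: (le_trans (tailN (tN N))).
  by rewrite lee_fin ler_expR tNE//; lra.
split.
- move=> t t0; apply: lesssim_neg_lne => [N| |e e0]; first exact: measure_ge0.
    near=> N; rewrite kappaE mulNr oppr_lt0; apply: mulr_gt0.
      exact: mulr_gt0.
    by apply: n0; near: N.
  have k0 : 0 < e * (kappa * t) / 2.
    by rewrite divr_gt0// (mulr_gt0 e0)// (mulr_gt0 kappa0).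
  near=> N.
  have N0 : (0 < N)%N by near: N.
  (* For fixed [t] any constant before [m * ln (n / m)] will do, as this term is [o(n)]; with [1]
     the constant is [2], whence the slack [e * (kappa * t) / 2]. *)
  have tailN1 : tail_le 1 N by near: N; exact: tail.
  apply: (le_trans (tailN1 t)).
  rewrite lee_fin ler_expR.
  have lnz : ln (n N / m N) <= e * (kappa * t) / 2 * (n N / m N).
    by apply: ln_le_mul => //; near: N; exact: near_ratio.
  have : m N * ln (n N / m N) <= e * (kappa * t) / 2 * n N.
    rewrite mulrC -ler_pdivlMr ?m0//; apply: le_trans lnz _.
    by rewrite mulrA.
  by rewrite kappaE; lra.
- apply: lesssim_neg_lne => [N| |e e0]; first exact: measure_ge0.
    near=> N; rewrite mulNr oppr_lt0 mulr_gt0 ?m0//; first by near: N.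
    by apply: (@lt_le_trans _ _ 1) => //; near: N.
  exact: tailN.
- have D0 : 0 < 20 * C / s by rewrite divr_gt0// mulr_gt0.
  have tN0 : \forall N \near \oo, 20 * C / s * (n N / m N)^-1 <= tN N.
    near=> N; rewrite /tN invf_div ler_peMr//; last by near: N.
    have N0 : (0 < N)%N by near: N.
    by rewrite !mulr_ge0 ?invr_ge0 ?(ltW C0) ?(ltW s0) ?(ltW (n0 _ N0)) ?(ltW (m0 _ N0)).
  have tN_gt0 : \forall N \near \oo, 0 < tN N.
    near=> N; have : 20 * C / s * (n N / m N)^-1 <= tN N by near: N.
    apply: lt_le_trans; have N0 : (0 < N)%N by near: N.
    by rewrite (mulr_gt0 D0)// invr_gt0 divr_gt0 ?n0 ?m0.
  apply: lesssim_pos_bound => // e e0; near=> N.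
  have N0 : (0 < N)%N by near: N.
  have tNpos : 0 < tN N by near: N.
  apply: (le_trans (@expectation_le_tail _ _ _ _ _ (tN N) ((2 * C) ^+ 2) (hmeas N)
    (ltW tNpos) (sqr_ge0 _) _)).
    move=> w; rewrite MSE_ge0 (MSE_le (phiC N))//; first by have [] := hxhat N w.
  (* Half of the exponent in (ii) is enough: once [4 <= m] the probability is at most
     [(n / m) ^ (-2)], of smaller order than [tN], which is at least [20 * C / s] times
     [(n / m)^-1]. *)
  have Ptail : (P N [set w | tN N <= mse N w]%R <=
      (expR ((1 - 1 / 2) * (- m N * ln (n N / m N))))%:E)%E.
    by near: N; apply: tailN; rewrite divr_gt0.
  apply: le_trans (leeD2l _ (lee_wpmul2l _ Ptail)) _; first by rewrite lee_fin sqr_ge0.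
  rewrite -EFinM -EFinD lee_fin [leRHS]mulrDl [X in X + e * _]mul1r lerD2l.
  have l1 : 1 <= ln (n N / m N) by near: N.
  have m4 : 4 <= m N.
    apply: le_trans (@num_params_ge R K dE dR hdE N); near: N.
    exact: nbhs_infty_ger.
  have z0 : 0 < n N / m N by rewrite divr_gt0 ?n0 ?m0.
  have expz : expR ((1 - 1 / 2) * (- m N * ln (n N / m N))) <= (n N / m N)^-1 ^+ 2.
    have -> : (n N / m N)^-1 ^+ 2 = expR (2 * - ln (n N / m N)).
      by rewrite expRM_natl expRN lnK ?posrE.
    by rewrite ler_expR; nra.
  apply: le_trans (ler_wpM2l (sqr_ge0 _) expz) _.
  have tNz : 20 * C / s * (n N / m N)^-1 <= tN N by near: N.
  apply: le_trans (ler_wpM2l (ltW e0) tNz).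
  have eD0 : 0 < e * (20 * C / s) := mulr_gt0 e0 D0.
  rewrite expr2 [leLHS]mulrA [leRHS]mulrA ler_wpM2r ?invr_ge0 ?(ltW z0)//.
  rewrite ler_pdivrMr// -ler_pdivrMl//.
  by near: N; exact: near_ratio.
Unshelve. all: by end_near.
Qed.
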